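(* Let $M=(J,\Sigma,\mu,\mathcal F)$ be a measurable matroid, and let $B_1,B_2$ be bases of $M$. Let $B_1=X_1\cup\dots\cup X_q$ be a measurable partition of $B_1$ into finitely many sets. Then, for every $\varepsilon>0$, there exists a measurable partition $B_2=Y_0\cup Y_1\cup\dots\cup Y_q$ such that $\mu(Y_0)\le\varepsilon$ and $(B_1\setminus X_i)\cup Y_i\in\mathcal F$ for every $i\in\{1,\dots,q\}$. In particular, each set $(B_1\setminus X_i)\cup Y_i$ can be extended to a basis of $M$ by adding a set of measure at most $\varepsilon$.
   Context: A standard measure space $(J,\Sigma,\mu)$ is a standard Borel space $(J,\Sigma)$ with a finite atomless measure $\mu\colon\Sigma\to[0,\infty)$. Convention: measurable sets are identified when they differ by a $\mu$-null set: $A=B$ means $\mu(A\triangle B)=0$, $A\subseteq B$ means $\mu(A\setminus B)=0$, and families of measurable sets are families in the measure algebra (membership is unaffected by null modifications). All sets are assumed measurable. Parts of a partition may be empty. A set $X$ in a family $\mathcal X$ is maximal in $\mathcal X$ if $X\subseteq Y\in\mathcal X$ implies $Y\subseteq X$. Write $\mathcal X|Z=\{X\in\mathcal X\mid X\subseteq Z\}$. A measurable matroid $M=(J,\Sigma,\mu,\mathcal F)$ consists of a standard measure space and a family $\mathcal F\subseteq\Sigma$ (the independent sets) satisfying: (I1) $\emptyset\in\mathcal F$; (I2) $F_1\subseteq F_2\in\mathcal F$ implies $F_1\in\mathcal F$; (I3) for all $X\in\Sigma$ and all maximal $F_1,F_2\in\mathcal F|X$, $\mu(F_1)=\mu(F_2)$;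 (I4) if $(F_i)_{i\in\mathbb N}$ is an increasing sequence in $\mathcal F$, then $\bigcup_i F_i\in\mathcal F$. Bases are the maximal members of $\mathcal F$. *)

(* Defs.v *)
From HB Require Import structures.
From mathcomp Require Import all_boot all_order all_algebra.
From mathcomp Require Import all_classical all_reals all_analysis.

Set Implicit Arguments.
Unset Strict Implicit.
Unset Printing Implicit Defensive.

Import Order.TTheory GRing.Theory Num.Theory.

Local Open Scope classical_set_scope.
Local Open Scope ring_scope.
Local Open Scope ereal_scope.

(* A Polish space is a separable complete metric space.  Completeness is
   phrased with [exists x, F --> x] rather than with the library's
   [completeType], so that [P] need not be pointed. *)
Definition polish (R : realType) (P : metricType R) : Prop :=
  (forall F : set_system P, ProperFilter F -> cauchy F ->
     exists x : P, F --> x) /\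
  (exists2 D : set P, countable D & dense D).

(* [J] is isomorphic, as a measurable space, to a Polish space with its Borel
   sigma-algebra. *)
Definition standard_borel (R : realType) (d : measure_display)
    (J : measurableType d) : Prop :=
  exists P : metricType R, polish P /\
  exists f : J -> P, bijective f /\
    forall A : set J, measurable A <-> <<s @open P >> (f @` A).

Definition atomless (R : realType) (d : measure_display)
    (J : measurableType d) (mu : set J -> \bar R) : Prop :=
  forall A : set J, measurable A -> 0 < mu A ->
    exists B : set J, [/\ measurable B, B `<=` A, 0 < mu B & mu B < mu A].

Section modulo_null.
Context (R : realType) (J : Type) (mu : set J -> \bar R).

(* Inclusion and equality in the measure algebra; as [mu] is meaningful on
   measurable sets only, so are these relations. *)
Definition sub_mod (A B : set J) : Prop := mu (A `\` B) = 0.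

Definition eq_mod (A B : set J) : Prop :=
  mu ((A `\` B) `|` (B `\` A)) = 0.

Definition maximal_in (XX : set (set J)) (X : set J) : Prop :=
  XX X /\ forall Y : set J, XX Y -> sub_mod X Y -> sub_mod Y X.

Definition family_below (XX : set (set J)) (Z : set J) : set (set J) :=
  [set X | XX X /\ sub_mod X Z].

End modulo_null.

(* Disjointness and covering hold up to null sets; parts may be empty. *)
Definition measurable_partition (R : realType) (d : measure_display)
    (J : measurableType d) (mu : set J -> \bar R) (I : finType)
    (A : set J) (X : I -> set J) : Prop :=
  [/\ forall i, measurable (X i),
      forall i j, i != j -> mu (X i `&` X j) = 0
    & eq_mod mu A (\bigcup_i X i)].

(* Since [indep_sub] uses inclusion modulo null sets, [indep] is invariant
   under null modifications. *)
Record measurable_matroid (R : realType) (d : measure_display)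
    (J : measurableType d) := MeasurableMatroid {
  mmeasure : {finite_measure set J -> \bar R} ;
  mm_standard_borel : standard_borel R J ;
  mm_atomless : atomless mmeasure ;
  indep : set (set J) ;
  indep_measurable : forall A, indep A -> measurable A ;
  indep0 : indep set0 ;
  indep_sub : forall F1 F2, measurable F1 -> sub_mod mmeasure F1 F2 ->
    indep F2 -> indep F1 ;
  indep_maximal : forall X F1 F2, measurable X ->
    maximal_in mmeasure (family_below mmeasure indep X) F1 ->
    maximal_in mmeasure (family_below mmeasure indep X) F2 ->
    mmeasure F1 = mmeasure F2 ;
  indep_bigcup : forall F : nat -> set J, (forall i, indep (F i)) ->
    (forall i, sub_mod mmeasure (F i) (F i.+1)) -> indep (\bigcup_i F i)
}.

Definition is_basis (R : realType) (d : measure_display)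
    (J : measurableType d) (M : measurable_matroid R J) (B : set J) : Prop :=
  maximal_in (mmeasure M) (indep M) B.

(* Main.v *)
Require Import Defs.
From mathcomp Require Import all_boot all_order all_algebra.
From mathcomp Require Import all_classical all_reals all_analysis.
From mathcomp Require Import lra.

(** Let [rk X] be the common measure of the maximal independent subsets of [X].
    It is submodular, as for finite matroids, once every independent subset of
    [X] is known to extend to a maximal one ([rk_extend]).  With
    [C i = B1 \ X i], what is sought is a splitting of [B2], up to a set of
    measure [eps], into parts [H i] such that [C i] together with [H i] is
    independent.  This is a partition of [B2] into independent sets of the
    contractions of [M] by the [C i].  As in the finite matroid partition
    theorem, the rank condition
      [m S + \sum_i m (C i) <= \sum_i rk (C i `|` S)] for all [S] inside [B2]
    is what makes it possible, and it follows from submodularity because the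
    [X i] partition the basis [B1] ([rk_sum_ge]).

    An atomless space has no single elements along which to augment, so the
    approximate partition theorem ([almost_partition]) is proved by deferred
    acceptance instead.  Every point of [E] goes through a list of [N * q]
    proposals, namely to the matroids 0, ..., q - 1 in turn, [N] times over;
    a round of [q] proposals is a level.  Each matroid keeps a greedy
    independent set of the points that currently propose to it, preferring
    those of higher level, and the rejected points move on to their next
    proposal.  A point once rejected by a matroid at level [l] stays in the span
    of what that matroid keeps at levels at least [l].  Hence, if [S] is the set
    of points beyond level [l], then [rk (C i `|` S) - m (C i)] is at most the
    measure of what matroid [i] keeps at levels at least [l]; summing over [i]
    and using the rank condition, [m S] is at most the measure of the points of
    level at least [l] that have not exhausted their list.  So every level
    loses at least the measure [u] of the exhausted points ([level_decrease]),
    and [(N + 1) u <= m E] ([exhausted_le]): for [N] large, [u <= eps / 2].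

    No limit of the procedure has to be taken.  The total progress of a
    consistent state is bounded, so some consistent state comes within [eps / 2]
    of the supremum; one more round from there increases the progress by the
    measure of the points it rejects ([progress_advance]), which is therefore
    at most [eps / 2].  The points kept in that round are the [H i]; they
    miss only the points rejected in it and the exhausted ones. *)

Import Order.TTheory GRing.Theory Num.Theory.

Local Open Scope classical_set_scope.
Local Open Scope ring_scope.

(** * Real values of a finite measure *)

Section real_measure.
Set Implicit Arguments.
Unset Strict Implicit.
Context {R : realType} {d : measure_display} {J : measurableType d}.
Variable mu : {finite_measure set J -> \bar R}.

Definition rmeas (A : set J) : R := fine (mu A).
Local Notation m := rmeas.

Lemma rmeasE {A : set J} : measurable A -> mu A = (m A)%:E.
Proof. by move=> mA; rewrite fineK// fin_num_measure. Qed.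

Lemma rmeas_ge0 (A : set J) : 0 <= m A.
Proof. exact/fine_ge0/measure_ge0. Qed.

Lemma rmeas0 : m set0 = 0.
Proof. by rewrite /rmeas measure0. Qed.

Lemma rmeas_split (A B : set J) : measurable A -> measurable B ->
  m A = m (A `\` B) + m (A `&` B).
Proof.
move=> mA mB; apply: EFin_inj; rewrite EFinD -!rmeasE//; first exact: measureDI.
  exact: measurableI.
exact: measurableD.
Qed.

Lemma rmeasU (A B : set J) : measurable A -> measurable B ->
  A `&` B = set0 -> m (A `|` B) = m A + m B.
Proof.
move=> mA mB AB; apply: EFin_inj; rewrite EFinD -!rmeasE//; last exact: measurableU.
exact: measureU.
Qed.

Lemma le_rmeas (A B : set J) : measurable A -> measurable B ->
  A `<=` B -> m A <= m B.
Proof. by move=> mA mB AB; rewrite -lee_fin -!rmeasE// le_measure// inE. Qed.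

Lemma rmeasUI (A B : set J) : measurable A -> measurable B ->
  m (A `|` B) + m (A `&` B) = m A + m B.
Proof.
move=> mA mB; rewrite (rmeas_split (measurableU _ _ mA mB) mB).
rewrite (_ : (A `|` B) `&` B = B); last first.
  by apply/seteqP; split=> [x []//|x Bx]; split=> //; right.
rewrite (_ : (A `|` B) `\` B = A `\` B); last first.
  by apply/seteqP; split=> [x [[]//]|x [Ax Bx]]; split=> //; left.
by rewrite (rmeas_split mA mB) addrAC.
Qed.

Lemma rmeasU_le (A B : set J) : measurable A -> measurable B ->
  m (A `|` B) <= m A + m B.
Proof. by move=> mA mB; rewrite -rmeasUI// lerDl rmeas_ge0. Qed.


(** Sums over a sequence rather than over a type, so that this and the next
    lemma go by induction on [s], removing [F i] from [A]. *)
Lemma rmeas_le_sum (I : eqType) (s : seq I) (F : I -> set J) (A : set J) :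
  (forall i, measurable (F i)) -> measurable A ->
  A `<=` [set x | exists2 i, i \in s & F i x] ->
  m A <= \sum_(i <- s) m (F i).
Proof.
move=> mF; elim: s A => [|i s IH] A mA sA.
  rewrite big_nil (_ : A = set0) ?rmeas0// -subset0 => x /sA[j].
  by rewrite in_nil.
rewrite big_cons (rmeas_split mA (mF i)) addrC lerD//.
  by apply: le_rmeas => //; exact: measurableI.
apply: IH; first exact: measurableD.
move=> x [/sA[j]]; rewrite inE => /predU1P[->//|js Fj _].
by exists j.
Qed.

Lemma sum_rmeas_le (I : eqType) (s : seq I) (F : I -> set J) (A : set J) :
  (forall i, measurable (F i)) -> measurable A -> uniq s ->
  (forall i, F i `<=` A) -> (forall i j x, F i x -> F j x -> i = j) ->
  \sum_(i <- s) m (F i) <= m A.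
Proof.
move=> mF mA us FA tF.
suff H : forall A, measurable A -> (forall i, i \in s -> F i `<=` A) ->
  \sum_(i <- s) m (F i) <= m A by exact: H.
elim: s us {A mA FA} => [_|i s IH /= /andP[is_ us]] A mA sA.
  by rewrite big_nil rmeas_ge0.
rewrite big_cons (rmeas_split mA (mF i)) addrC lerD//.
  apply: IH => //; first exact: measurableD.
  move=> j js x Fjx; split; first by apply: (sA j) Fjx; rewrite inE js orbT.
  by move=> Fix; move: is_; rewrite (tF _ _ _ Fix Fjx) js.
apply: le_rmeas => //; first exact: measurableI.
by move=> x Fx; split=> //; apply: (sA i) Fx; rewrite mem_head.
Qed.

End real_measure.

(** * Rank in a measurable matroid *)

Section rank.
Set Implicit Arguments.
Unset Strict Implicit.
Context {R : realType} {d : measure_display} {J : measurableType d}.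
Variable M : measurable_matroid R J.
Local Notation mu := (mmeasure M).
Local Notation m := (rmeas (mmeasure M)).

Let measurable_indep (F : set J) : indep M F -> measurable F.
Proof. exact: indep_measurable. Qed.

Lemma sub_modP (A B : set J) : measurable A -> measurable B ->
  sub_mod mu A B <-> m (A `\` B) = 0.
Proof.
move=> mA mB; rewrite /sub_mod rmeasE; last exact: measurableD.
by split=> [[]|->].
Qed.

Lemma subset_sub_mod (A B : set J) : A `<=` B -> sub_mod mu A B.
Proof. by move=> AB; rewrite /sub_mod (_ : A `\` B = set0) ?measure0// setD_eq0. Qed.

Lemma indep_subset (F1 F2 : set J) : measurable F1 -> F1 `<=` F2 ->
  indep M F2 -> indep M F1.
Proof. by move=> mF1 F12; apply: indep_sub => //; exact: subset_sub_mod. Qed.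

(** Exhaustion: each step extends the current set almost as much as is
    possible, with an error that tends to 0, and [indep_bigcup] makes the union
    of the steps independent.  Independent supersets of the union compete at every
    step, so they cannot be larger. *)
Lemma indep_extend (F X : set J) : measurable X -> indep M F -> F `<=` X ->
  exists G : set J, [/\ indep M G, F `<=` G, G `<=` X &
    forall H : set J, indep M H -> G `<=` H -> H `<=` X -> m H <= m G].
Proof.
move=> mX iF FX.
pose above (G : set J) : set R :=
  [set m H | H in [set H | [/\ indep M H, G `<=` H & H `<=` X]]].
have ub_above (G : set J) : has_ubound (above G).
  exists (m X) => _ [H [iH GH HX] <-].
  by apply: le_rmeas => //; exact: measurable_indep iH.
(* The index [p.1] only sets the error [p.1.+1%:R^-1] allowed at this step. *)
have /choice[step stepP] : forall p : nat * set J, exists H : set J,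
    indep M p.2 -> p.2 `<=` X ->
    [/\ indep M H, p.2 `<=` H, H `<=` X & sup (above p.2) - p.1.+1%:R^-1 < m H].
  move=> [n G] /=; have [[iG GX]|nG] := pselect (indep M G /\ G `<=` X); last first.
    by exists set0 => iG GX; case: nG.
  have sG : has_sup (above G).
    by split; [exists (m G); exists G; split | exact: ub_above].
  have [|_ [H [iH GH HX] <-] lt_H] := @sup_adherent R (above G) n.+1%:R^-1 _ sG.
    by rewrite invr_gt0 ltr0n.
  by exists H.
pose G := fix G n := if n is n'.+1 then step (n', G n') else F.
have GP n : indep M (G n) /\ G n `<=` X.
  elim: n => [//|n [iG GX]].
  by have [] := stepP (n, G n) iG GX.
have GS n : G n `<=` G n.+1.
  by have [iG GX] := GP n; have [] := stepP (n, G n) iG GX.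
have iU : indep M (\bigcup_n G n).
  by apply: indep_bigcup => [i|i]; [have [] := GP i | exact: subset_sub_mod].
exists (\bigcup_n G n); split=> //.
- by move=> x Fx; exists 0%N.
- by move=> x [n _]; have [_] := GP n; exact.
move=> H iH UH HX; apply/ler_addgt0Pr => e e0.
pose n := Num.truncn e^-1.
have ne : n.+1%:R^-1 < e.
  rewrite -[ltRHS]invrK ltf_pV2 ?posrE ?ltr0n ?invr_gt0//.
  exact: truncnS_gt.
have lt_G : sup (above (G n)) - n.+1%:R^-1 < m (G n.+1).
  by have [iG GX] := GP n; have [] := stepP (n, G n) iG GX.
have HG : m H <= sup (above (G n)).
  apply: ub_le_sup => //; exists H => //; split=> //.
  by move=> x Gx; apply: UH; exists n.
have GU : m (G n.+1) <= m (\bigcup_n G n).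
  by apply: le_rmeas; [apply: indep_measurable (GP n.+1).1 |
     exact: measurable_indep iU | move=> x Gx; exists n.+1].
apply: (le_trans HG); rewrite -lerBlDr; apply: le_trans GU; apply: ltW.
by apply: le_lt_trans lt_G; rewrite lerD2l lerN2 ltW.
Qed.

(** Maximality for the inclusion of sets implies maximality modulo null sets,
    which is what [indep_maximal] speaks about: a competitor [Y] may be replaced by
    [G `|` (Y `&` X)], which differs from it by a null set. *)
Lemma maximal_below (G X : set J) : measurable X -> indep M G -> G `<=` X ->
  (forall H : set J, indep M H -> G `<=` H -> H `<=` X -> m H <= m G) ->
  maximal_in mu (family_below mu (indep M) X) G.
Proof.
move=> mX iG GX maxG; split; first by split=> //; exact: subset_sub_mod.
have mG := indep_measurable iG.
move=> Y [iY YX] GY; have mY := indep_measurable iY.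
have mYX : measurable (Y `&` X) by exact: measurableI.
have mH : measurable (G `|` (Y `&` X)) by exact: measurableU.
have iH : indep M (G `|` (Y `&` X)).
  apply: (indep_sub mH _ iY); apply/sub_modP => //; move/sub_modP: GY => /(_ mG mY) GY.
  apply/eqP; rewrite eq_le rmeas_ge0 andbT -GY; apply: le_rmeas.
  - exact: measurableD.
  - exact: measurableD.
  - by move=> x [[Gx|[Yx _]] nYx] //.
have := maxG _ iH; rewrite (rmeas_split _ mH mG) => /(_ _ _)/=.
have -> : (G `|` (Y `&` X)) `&` G = G.
  by apply/seteqP; split=> [x []//|x Gx]; split=> //; left.
have -> : (G `|` (Y `&` X)) `\` G = (Y `&` X) `\` G.
  by apply/seteqP; split=> [x [[]//]|x [Ax Bx]]; split=> //; right.
move=> le_m; apply/sub_modP => //.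
have {}le_m : m ((Y `&` X) `\` G) <= 0.
  by rewrite -(gerDr (m G)); apply: le_m => [x Gx|x [/GX//|[]//]]; left.
move/sub_modP: YX => /(_ mY mX) YX.
have mYG : measurable (Y `\` G) by exact: measurableD.
apply/eqP; rewrite eq_le rmeas_ge0 andbT (rmeas_split _ mYG mX).
rewrite -[leRHS]addr0 lerD//.
  rewrite -YX; apply: le_rmeas; try exact: measurableD.
  by move=> x [[]].
apply: le_trans le_m; apply: le_rmeas; try exact: measurableD.
  exact: measurableI.
by move=> x [[Yx nGx] Xx].
Qed.

Definition rk (X : set J) : R :=
  sup [set m F | F in [set F | indep M F /\ F `<=` X]].

Lemma rk_extend (F X : set J) : measurable X -> indep M F -> F `<=` X ->
  exists G : set J, [/\ indep M G, F `<=` G, G `<=` X & m G = rk X].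
Proof.
move=> mX iF FX; have [G [iG FG GX maxG]] := indep_extend mX iF FX.
exists G; split=> //; apply/le_anti/andP; split.
  apply: ub_le_sup; last by exists G.
  exists (m X) => _ [H [iH HX] <-].
  by apply: le_rmeas => //; exact: measurable_indep iH.
apply: ge_sup; first by exists (m G); exists G.
move=> _ [H [iH HX] <-].
have [H' [iH' HH' H'X maxH']] := indep_extend mX iH HX.
have := indep_maximal mX (maximal_below mX iG GX maxG) (maximal_below mX iH' H'X maxH').
rewrite (rmeasE _ (indep_measurable iG)) (rmeasE _ (indep_measurable iH')) => -[->].
by apply: le_rmeas => //; exact: measurable_indep.
Qed.

Lemma le_rmeas_rk (F X : set J) : measurable X -> indep M F -> F `<=` X ->
  m F <= rk X.
Proof.
move=> mX iF FX; have [G [iG FG GX <-]] := rk_extend mX iF FX.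
by apply: le_rmeas => //; exact: measurable_indep.
Qed.

Lemma le_rk (X Y : set J) : measurable X -> measurable Y -> X `<=` Y ->
  rk X <= rk Y.
Proof.
move=> mX mY XY; have [G [iG _ GX <-]] := rk_extend mX (indep0 M) (sub0set X).
by apply: le_rmeas_rk => //; exact: subset_trans XY.
Qed.

Lemma rk_indep (F : set J) : indep M F -> rk F = m F.
Proof.
move=> iF; have mF := indep_measurable iF; apply/le_anti/andP; split.
  have [G [iG _ GX <-]] := rk_extend mF (indep0 M) (sub0set F).
  by apply: le_rmeas => //; exact: measurable_indep.
exact: le_rmeas_rk.
Qed.

(** Extend a maximal independent subset [F] of [X `&` Y] to a maximal
    independent subset [G] of [X `|` Y], and count [G] in [X] and in [Y]. *)
Lemma rk_submod (X Y : set J) : measurable X -> measurable Y ->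
  rk (X `|` Y) + rk (X `&` Y) <= rk X + rk Y.
Proof.
move=> mX mY.
have mI : measurable (X `&` Y) by exact: measurableI.
have mU : measurable (X `|` Y) by exact: measurableU.
have [F [iF _ FI Fr]] := rk_extend mI (indep0 M) (sub0set _).
have [G [iG FG GU <-]] : exists G : set J,
    [/\ indep M G, F `<=` G, G `<=` X `|` Y & m G = rk (X `|` Y)].
  by apply: rk_extend => // x /FI[Xx _]; left.
have mG := indep_measurable iG.
have mGX : measurable (G `&` X) by exact: measurableI.
have mGY : measurable (G `&` Y) by exact: measurableI.
have iGX : indep M (G `&` X) by apply: indep_subset iG.
have iGY : indep M (G `&` Y) by apply: indep_subset iG.
have leF : m F <= m ((G `&` X) `&` (G `&` Y)).
  apply: le_rmeas; [exact: measurable_indep|exact: measurableI|].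
  by move=> x Fx; have [] := FI _ Fx; have := FG _ Fx.
have leG : m G <= m ((G `&` X) `|` (G `&` Y)).
  apply: le_rmeas => //; first exact: measurableU.
  by move=> x Gx; have [] := GU _ Gx; [left|right].
have := rmeasUI mu mGX mGY.
have := le_rmeas_rk mX iGX (@subIsetr _ _ _).
have := le_rmeas_rk mY iGY (@subIsetr _ _ _).
move: leF leG; rewrite Fr; lra.
Qed.

(** Spans are monotone: [rk V <= rk T] says that [T] spans [V], and then the
    larger [W] spans it too, by submodularity applied to [W] and [V]. *)
Lemma rk_absorb (T V W : set J) : measurable T -> measurable V -> measurable W ->
  T `<=` V -> T `<=` W -> rk V <= rk T -> rk (W `|` V) = rk W.
Proof.
move=> mT mV mW TV TW le_r; apply/le_anti/andP; split; last first.
  by apply: le_rk => //; exact: measurableU.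
have := rk_submod mW mV.
have : rk T <= rk (W `&` V) by apply: le_rk => //; [exact: measurableI|move=> x Tx; split; auto].
lra.
Qed.

(** The greedy algorithm for the priorities given by a decreasing chain [D],
    in the contraction of [M] by [C]: extending from the innermost [D l]
    outwards makes [H] optimal in all the [D l] at once. *)
Lemma greedy_chain (C : set J) (D : nat -> set J) (N : nat) :
  indep M C -> (forall l, measurable (D l)) -> (forall l, D l.+1 `<=` D l) ->
  D N = set0 ->
  exists H : set J, [/\ measurable H, H `<=` D 0%N, H `&` C = set0,
    indep M (C `|` H) & forall l, m C + m (H `&` D l) = rk (C `|` D l)].
Proof.
move=> iC; have mC := indep_measurable iC.
elim: N D => [|N IH] D mD DS DN.
  have D0 l : D l = set0.
    by elim: l => [//|l IH]; rewrite -subset0 -IH.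
  exists set0; rewrite set0I setU0; split=> // l.
  by rewrite D0 setU0 set0I rmeas0 addr0 rk_indep.
have [H' [mH' H'D H'C iH' H'r]] := IH (D \o S) (fun l => mD _) (fun l => DS _) DN.
have mU l : measurable (C `|` D l) by exact: measurableU.
have H'0 : C `|` H' `<=` C `|` D 0%N.
  by move=> x [Cx|/H'D/DS D0x]; [left|right].
have [G [iG H'G GD Gr]] := rk_extend (mU 0%N) iH' H'0.
have mG := indep_measurable iG.
have mH : measurable (G `\` C) by exact: measurableD.
have mHD l : measurable ((G `\` C) `&` D l) by exact: measurableI.
have CG : C `<=` G by move=> x Cx; apply: H'G; left.
have leH l : m C + m ((G `\` C) `&` D l) <= rk (C `|` D l).
  rewrite -rmeasU//; last by apply/seteqP; split=> [x [Cx [[_ /(_ Cx)]]]|].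
  apply: le_rmeas_rk => //.
    by apply: indep_subset iG; [exact: measurableU|move=> x [/CG|[[]]]].
  by move=> x [Cx|[_ Dx]]; [left|right].
exists (G `\` C); split=> //.
- by move=> x [/GD[]].
- by apply/seteqP; split=> [x [[_ nCx] /nCx]|].
- by apply: indep_subset iG; [exact: measurableU|move=> x [/CG//|[]//]].
move=> l; apply/le_anti/andP; split=> //; case: l => [|l].
  rewrite -Gr -rmeasU//.
    apply: le_rmeas => //; first exact: measurableU.
    by move=> x Gx; have [Cx|nCx] := pselect (C x); [left|right; have [] := GD _ Gx].
  by apply/seteqP; split=> [x [Cx [[_ /(_ Cx)]]]|].
rewrite -H'r lerD2l; apply: le_rmeas => //; first exact: measurableI mH' (mD l.+1).
move=> x [H'x Dx]; split=> //; split; first by apply: H'G; right.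
by move=> Cx; have : (H' `&` C) x by []; rewrite H'C.
Qed.

End rank.

(** * Approximate matroid partition by deferred acceptance *)

Section deferred_acceptance.
Set Implicit Arguments.
Unset Strict Implicit.
Context {R : realType} {d : measure_display} {J : measurableType d}.
Variables (M : measurable_matroid R J) (q N : nat) (C : 'I_q -> set J) (E : set J).
Hypotheses (iC : forall i, indep M (C i)) (mE : measurable E).
Local Notation m := (rmeas (mmeasure M)).

Let mC i : measurable (C i). Proof. exact: indep_measurable (iC i). Qed.

(** Proposal number [k = l * q + i] is addressed to matroid [i] at level [l];
    [pos x] is the current proposal of [x], and [pos x = N * q] means that [x]
    has been rejected everywhere. *)
Definition cand (pos : J -> nat) (i : 'I_q) (l : nat) : set J :=
  E `&` pos @^-1` [set k | [/\ (k < N * q)%N, (k %% q)%N = i & (l * q + i <= k)%N]].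

Definition past (pos : J -> nat) (k : nat) : set J := E `&` pos @^-1` [set j | (k < j)%N].

(** The last condition says that the points that have moved past proposal
    [l * q + i] had to: they lie in the span of the better or equal proposals
    to matroid [i]. *)
Definition consistent (pos : J -> nat) : Prop :=
  [/\ forall P : set nat, measurable (pos @^-1` P),
      forall x, (pos x <= N * q)%N
    & forall (i : 'I_q) l,
        rk M ((C i `|` cand pos i l) `|` past pos (l * q + i)) <= rk M (C i `|` cand pos i l)].

(** [H i] is what matroid [i] keeps, optimal for all levels at once as provided
    by [greedy_chain]. *)
Definition accepting (pos : J -> nat) (H : 'I_q -> set J) : Prop :=
  forall i, [/\ measurable (H i), H i `<=` cand pos i 0, H i `&` C i = set0,
    indep M (C i `|` H i)
    & forall l, m (C i) + m (H i `&` cand pos i l) = rk M (C i `|` cand pos i l)].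

Definition rejected (pos : J -> nat) (H : 'I_q -> set J) : set J :=
  (E `&` pos @^-1` [set k | (k < N * q)%N]) `\` \bigcup_i H i.

Definition advance (pos : J -> nat) (H : 'I_q -> set J) (x : J) : nat :=
  if x \in rejected pos H then (pos x).+1 else pos x.

(** This is the integral of [pos] over [E], since [pos x] counts the [k] with
    [k < pos x]. *)
Definition progress (pos : J -> nat) : R := \sum_(0 <= k < N * q) m (past pos k).

Lemma consistent0 : consistent (fun=> 0%N).
Proof.
split=> [P|//|i l]; first by rewrite preimage_cst; case: ifP.
by rewrite (_ : past _ _ = set0) ?setU0// -subset0 => x [].
Qed.

Section state.
Variables (pos : J -> nat) (H : 'I_q -> set J).
Hypotheses (cpos : consistent pos) (aH : accepting pos H).

Let mpos (P : set nat) : measurable (pos @^-1` P). Proof. by case: cpos. Qed.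

Let mcand i l : measurable (cand pos i l).
Proof. by apply: measurableI => //; exact: mpos. Qed.

Let mpast k : measurable (past pos k).
Proof. by apply: measurableI => //; exact: mpos. Qed.

Let mH i : measurable (H i). Proof. by case: (aH i). Qed.

Let mbigH : measurable (\bigcup_i H i).
Proof. by apply: fin_bigcup_measurable => //; exact: finite_finset. Qed.

Lemma accepting_disjoint i j x : H i x -> H j x -> i = j.
Proof.
have [_ Hi _ _ _] := aH i; have [_ Hj _ _ _] := aH j.
by move=> /Hi[_ [_ ei _]] /Hj[_ [_ ej _]]; apply: val_inj; exact: etrans (esym ei) ej.
Qed.

Lemma measurable_rejected : measurable (rejected pos H).
Proof. by apply: measurableD => //; apply: measurableI => //; exact: mpos. Qed.

(** What matroid [i] keeps at levels at least [l] spans all the candidates of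
    these levels, hence also the points rejected now or earlier at proposal
    [l * q + i]; and the kept points are still candidates after the round, so
    the span can only grow. *)
Lemma advance_consistent : consistent (advance pos H).
Proof.
have mrej := measurable_rejected.
have mpos' (P : set nat) : measurable (advance pos H @^-1` P).
  rewrite (_ : _ @^-1` P = (rejected pos H `&` pos @^-1` [set k | P k.+1])
                     `|` (pos @^-1` P `\` rejected pos H)).
    by apply: measurableU; [apply: measurableI|apply: measurableD].
  apply/seteqP; split=> x; rewrite /preimage/= /advance.
    by case: ifPn => [/set_mem|/negP nr Px]; [left|right; split=> // /mem_set].
  by case=> [[/mem_set -> //]|[Px nr]]; case: ifPn => // /set_mem.
split=> // [x|i l].
  rewrite /advance; case: ifPn => [/set_mem[[_]]//|_].
  by case: cpos.
have mcand' : measurable (cand (advance pos H) i l).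
  by apply: measurableI => //; exact: mpos'.
have mpast' : measurable (past (advance pos H) (l * q + i)).
  by apply: measurableI => //; exact: mpos'.
have [_ Hcand HC iHC Hr] := aH i.
(* [T] spans [V], and still lies within [C i] and the candidates after the
   round. *)
pose T := C i `|` (H i `&` cand pos i l).
pose V := (C i `|` cand pos i l) `|` past pos (l * q + i).
have mHc : measurable (H i `&` cand pos i l) by exact: measurableI.
have mT : measurable T by exact: measurableU.
have mV : measurable V by apply: measurableU => //; exact: measurableU.
have mW : measurable (C i `|` cand (advance pos H) i l) by exact: measurableU.
have iT : indep M T.
  by apply: indep_subset iHC => // x [|[]]; [left|right].
have VT : rk M V <= rk M T.
  case: cpos => _ _ /(_ i l) /le_trans; apply.
  rewrite -Hr (rk_indep iT) rmeasU//.
  by rewrite -subset0 => x [Cx [Hx _]]; rewrite -HC.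
have TV : T `<=` V by move=> x [Cx|[_ cx]]; left; [left|right].
have TW : T `<=` C i `|` cand (advance pos H) i l.
  move=> x [Cx|[Hx [Ex cx]]]; [by left|right; split=> //].
  rewrite /preimage/= /advance; case: ifPn => // /set_mem[_ []].
  by exists i.
(* Every point past [l * q + i] after the round was past it before, or was a
   candidate at exactly that proposal and has just been rejected. *)
rewrite -(rk_absorb mT mV mW TV TW VT).
apply: le_rk; [exact: measurableU|exact: measurableU|].
move=> x [Wx|[Ex /= xpos]]; [by left|right; move: xpos].
rewrite /advance; case: ifPn => [/set_mem[[_ xN] _]|_ xpos]; last by right.
rewrite ltnS leq_eqVlt => /predU1P[xpos|xpos]; last by right.
left; right; split=> //; split=> //; first by rewrite -xpos modnMDl modn_small.
by rewrite -xpos.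
Qed.

Lemma progress_advance :
  progress pos + m (rejected pos H) <= progress (advance pos H).
Proof.
have mrej := measurable_rejected.
have mk k : measurable (rejected pos H `&` pos @^-1` [set k]).
  by apply: measurableI => //; exact: mpos.
have rejE : m (rejected pos H) <=
    \sum_(0 <= k < N * q) m (rejected pos H `&` pos @^-1` [set k]).
  apply: rmeas_le_sum => // x rx; exists (pos x); last by [].
  by rewrite mem_index_iota; case: rx => [[]].
apply: le_trans (_ : _ <= progress pos + _) _; first by rewrite lerD2l; exact: rejE.
rewrite -big_split; apply: ler_sum => k _ /=.
rewrite -rmeasU//; last by rewrite -subset0 => x [[_ kx] [_ xk]]; move: kx; rewrite /= xk ltnn.
case: advance_consistent => mpos' _ _.
apply: le_rmeas; [exact: measurableU|by apply: measurableI => //; exact: mpos'|].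
move=> x [[Ex kx]|[rx /= xk]].
  by split=> //; rewrite /preimage/= /advance; case: ifP => // _; exact: leqW.
split; first by case: rx => [[]].
by rewrite /preimage/= /advance (mem_set rx) xk.
Qed.

(* The rank condition of the matroid partition theorem for the contractions of
   [M] by the [C i], cleared of subtraction. *)
Hypothesis rank_cond : forall S : set J, measurable S -> S `<=` E ->
  m S + \sum_i m (C i) <= \sum_i rk M (C i `|` S).

(** The points beyond level [l] are spanned by what is kept at levels at least
    [l], and all of that lies among the points of level at least [l] that have
    not exhausted their list. *)
Lemma level_decrease l : (l < N)%N ->
  m (E `&` pos @^-1` [set k | (l.+1 * q <= k)%N]) +
  m (E `&` pos @^-1` [set k | (N * q <= k)%N]) <=
  m (E `&` pos @^-1` [set k | (l * q <= k)%N]).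
Proof.
move=> lN.
have mEpos (P : set nat) : measurable (E `&` pos @^-1` P).
  by apply: measurableI => //; exact: mpos.
set S := E `&` _; set U := E `&` pos @^-1` [set k | (N * q <= k)%N].
have mS : measurable S by exact: mEpos.
pose A := E `&` pos @^-1` [set k | (l * q <= k < N * q)%N].
have mA : measurable A by exact: mEpos.
have -> : m (E `&` pos @^-1` [set k | (l * q <= k)%N]) = m A + m U.
  rewrite -rmeasU//; last 2 first.
  - exact: mEpos.
  - rewrite -subset0 => x [[_ /= /andP[_ xN]] [_ /=]].
    by rewrite leqNgt xN.
  congr m; apply/seteqP; split=> x.
    move=> [Ex /= lx]; have [xN|xN] := ltnP (pos x) (N * q).
      by left; split=> //=; rewrite lx.
    by right.
  case=> [[Ex /= /andP[]]//|[Ex /= xN]]; split=> //=.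
  by apply: leq_trans xN; rewrite leq_mul2r ltnW ?orbT.
rewrite lerD2r.
have sumH : \sum_i m (H i `&` cand pos i l) <= m A.
  apply: sum_rmeas_le => //.
  - by move=> i; exact: measurableI.
  - exact: index_enum_uniq.
  - move=> i x [_ [Ex [/= xN _ lx]]]; split=> //=.
    by rewrite xN andbT (leq_trans _ lx)// leq_addr.
  - by move=> i j x [Hi _] [Hj _]; exact: accepting_disjoint Hj.
have leS : \sum_i rk M (C i `|` S) <= \sum_i (m (C i) + m (H i `&` cand pos i l)).
  apply: ler_sum => i _; have [_ _ _ _ ->] := aH i.
  case: cpos => _ _ /(_ i l); apply: le_trans; apply: le_rk.
  - exact: measurableU.
  - by apply: measurableU => //; exact: measurableU.
  move=> x [Cx|[Ex /= xl]]; [by left; left|right; split=> //=].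
  by apply: leq_trans xl; rewrite mulSn addnC ltn_add2r.
have := rank_cond mS (@subIsetl _ _ _).
rewrite big_split/= in leS.
lra.
Qed.

Lemma exhausted_le :
  N.+1%:R * m (E `&` pos @^-1` [set k | (N * q <= k)%N]) <= m E.
Proof.
have H0 l : (l <= N)%N -> m (E `&` pos @^-1` [set k | (l * q <= k)%N]) +
    l%:R * m (E `&` pos @^-1` [set k | (N * q <= k)%N]) <= m E.
  elim: l => [_|l IH lN].
    rewrite mul0r addr0; apply: le_rmeas => //.
    by apply: measurableI => //; exact: mpos.
  apply: le_trans (IH (ltnW lN)).
  have := level_decrease lN; rewrite -natr1 mulrDl mul1r; lra.
by have := H0 _ (leqnn N); rewrite -natr1 mulrDl mul1r addrC.
Qed.

End state.

End deferred_acceptance.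

Section partition.
Set Implicit Arguments.
Unset Strict Implicit.
Context {R : realType} {d : measure_display} {J : measurableType d}.
Variables (M : measurable_matroid R J).
Local Notation m := (rmeas (mmeasure M)).

(** The approximate form of the matroid partition theorem, for the contractions
    of [M] by independent sets [C i]. *)
Lemma almost_partition (q : nat) (C : 'I_q -> set J) (E : set J) (eps : R) :
  (forall i, indep M (C i)) -> measurable E ->
  (forall S : set J, measurable S -> S `<=` E ->
    m S + \sum_i m (C i) <= \sum_i rk M (C i `|` S)) ->
  0 < eps ->
  exists H : 'I_q -> set J, [/\ forall i, measurable (H i) /\ H i `<=` E,
    forall i j x, H i x -> H j x -> i = j,
    forall i, H i `&` C i = set0 /\ indep M (C i `|` H i) &
    m (E `\` \bigcup_i H i) <= eps].
Proof.
move=> iC mE rank_cond e0.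
have e20 : 0 < eps / 2 by rewrite divr_gt0.
(* Enough levels for [(N + 1) * (eps / 2)] to exceed [m E]. *)
pose N := Num.truncn (m E / (eps / 2)).
pose values : set R := [set progress M q N E pos | pos in consistent M N C E].
have sv : has_sup values.
  split; first by exists (progress M q N E (fun=> 0%N)); exists (fun=> 0%N) => //; exact: consistent0.
  exists (\sum_(0 <= k < N * q) m E) => _ [pos [mpos _ _] <-].
  apply: ler_sum => k _; apply: le_rmeas => //; last by move=> x [].
  by apply: measurableI => //; exact: mpos.
have [_ [pos cpos <-] ltp] := sup_adherent e20 sv.
have mpos (P : set nat) : measurable (pos @^-1` P) by case: cpos.
have mcand i l : measurable (cand N E pos i l).
  by apply: measurableI => //; exact: mpos.
have /choice[H aH] : forall i : 'I_q, exists H : set J,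
    [/\ measurable H, H `<=` cand N E pos i 0, H `&` C i = set0,
    indep M (C i `|` H)
    & forall l, m (C i) + m (H `&` cand N E pos i l) = rk M (C i `|` cand N E pos i l)].
  move=> i; apply: (@greedy_chain _ _ _ M (C i) (cand N E pos i) N) => //.
    move=> l x [Ex [/= xN xq xl]]; split=> //; split=> //.
    by apply: leq_trans xl; rewrite mulSn -addnA leq_addl.
  rewrite -subset0 => x [Ex [/= xN _]].
  by rewrite leqNgt (leq_trans xN)// leq_addr.
have mrej := measurable_rejected mE cpos aH.
have mU : measurable (E `&` pos @^-1` [set k | (N * q <= k)%N]).
  by apply: measurableI => //; exact: mpos.
exists H; split.
- by move=> i; have [mH HE _ _ _] := aH i; split=> // x /HE[].
- by move=> i j x; exact: accepting_disjoint aH _ _ _.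
- by move=> i; have [] := aH i.
have lerej : m (rejected N E pos H) <= eps / 2.
  have := progress_advance iC mE cpos aH.
  have : progress M q N E (advance N E pos H) <= sup values.
    by apply: sup_upper_bound => //; exists (advance N E pos H) => //; exact: advance_consistent.
  lra.
have leU : m (E `&` pos @^-1` [set k | (N * q <= k)%N]) <= eps / 2.
  rewrite -(ler_pM2l (ltr0Sn R N)); apply: le_trans (exhausted_le iC mE cpos aH rank_cond) _.
  by rewrite -ler_pdivrMr// ltW// truncnS_gt.
rewrite (splitr eps); apply: le_trans (lerD lerej leU).
apply: le_trans (rmeasU_le _ mrej mU); apply: le_rmeas.
- apply: measurableD => //; apply: fin_bigcup_measurable; first exact: finite_finset.
  by move=> i _; have [] := aH i.
- exact: measurableU.
move=> x [Ex nHx]; have [xN|xN] := ltnP (pos x) (N * q); last by right.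
by left.
Qed.

End partition.

(** * Exchange between bases *)

Section bases.
Set Implicit Arguments.
Unset Strict Implicit.
Context {R : realType} {d : measure_display} {J : measurableType d}.
Variables (M : measurable_matroid R J).
Local Notation m := (rmeas (mmeasure M)).

Lemma basis_rk (B : set J) : is_basis M B -> m B = rk M setT.
Proof.
move=> [iB maxB]; have mB := indep_measurable iB.
have [G [iG BG _ <-]] := rk_extend measurableT iB (@subsetT _ B).
have mG := indep_measurable iG.
have := maxB G iG (subset_sub_mod M BG); move/sub_modP => /(_ mG mB) GB.
by rewrite (rmeas_split _ mG mB) GB add0r setIidr.
Qed.

Lemma rk_basis (G : set J) : indep M G -> m G = rk M setT -> is_basis M G.
Proof.
move=> iG Gr; have mG := indep_measurable iG; split=> // Y iY.
have mY := indep_measurable iY; move=> /sub_modP => /(_ mG mY) GY.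
apply/sub_modP => //.
have := le_rmeas_rk measurableT iY (@subsetT _ Y).
rewrite -Gr (rmeas_split _ mY mG) (rmeas_split _ mG mY) GY setIC add0r gerDr.
by move=> le0; apply/eqP; rewrite eq_le le0 rmeas_ge0.
Qed.

(** The rank condition: by induction on [s], uncrossing [C i `|` S] with
    [S `|` D], where [D] is the intersection of the other [C j].  The union
    contains [C i `|` D], which is almost all of [B] because the complements of
    the [C j] in [B] are almost disjoint, so its rank is that of [M]. *)
Lemma rk_sum_ge (I : eqType) (B S : set J) (C : I -> set J) (s : seq I) :
  is_basis M B -> (forall i, measurable (C i) /\ C i `<=` B) ->
  (forall i j, i != j -> m (B `\` (C i `|` C j)) = 0) ->
  measurable S -> uniq s ->
  (size s)%:R * m B + rk M (S `|` \big[setI/B]_(i <- s) C i) <=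
  m B + \sum_(i <- s) rk M (C i `|` S).
Proof.
move=> bB CB CC mS; have iB : indep M B by case: bB.
have mB := indep_measurable iB; have mC i := (CB i).1.
have mD (t : seq I) : measurable (\big[setI/B]_(i <- t) C i).
  by elim: t => [|i t IH]; rewrite ?big_nil// big_cons; exact: measurableI.
have subD (t : seq I) : \big[setI/B]_(i <- t) C i `<=` B.
  by elim: t => [|i t IH]; rewrite ?big_nil// big_cons => x [_ /IH].
have Dmiss (t : seq I) x : B x -> ~ (\big[setI/B]_(i <- t) C i) x ->
    exists2 j, j \in t & ~ C j x.
  move=> Bx; elim: t => [|i t IH]; first by rewrite big_nil.
  rewrite big_cons => nCD; have [Cx|nC] := pselect (C i x); last first.
    by exists i => //; rewrite mem_head.
  have [|k kt nk] := IH; first by move=> Dx; apply: nCD.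
  by exists k => //; rewrite inE kt orbT.
elim: s => [_|i s IH /= /andP[is_ us]].
  rewrite !big_nil mul0r add0r addr0 (basis_rk bB); apply: le_rk => //.
  exact: measurableU.
rewrite !big_cons; set D := \big[setI/B]_(j <- s) C j in IH *.
have DB : D `<=` B by exact: subD.
have mDs : measurable D by exact: mD.
have mCD : measurable (C i `|` D) by exact: measurableU.
have mBCD : measurable (B `\` (C i `|` D)) by exact: measurableD.
have CDB : C i `|` D `<=` B by move=> x [Cx|Dx]; [apply: (CB i).2|apply: DB].
have CD : m (C i `|` D) = m B.
  rewrite (rmeas_split _ mB mCD) setIidr// [X in _ = X + _](_ : _ = 0) ?add0r//.
  apply/eqP; rewrite eq_le rmeas_ge0 andbT.
  apply: le_trans (_ : _ <= \sum_(j <- s) m (B `\` (C i `|` C j))) _.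
    apply: rmeas_le_sum => //.
      by move=> j; apply: measurableD => //; exact: measurableU.
    move=> x [Bx nx]; have nD : ~ D x by move=> Dx; apply: nx; right.
    have [j js nC] := Dmiss s x Bx nD.
    exists j => //; split=> // -[Ci|//]; apply: nx; by left.
  rewrite big_seq big1// => j js; apply: CC.
  by apply: contraNneq is_ => ->.
have mSD : measurable (S `|` D) by exact: measurableU.
have mCS : measurable (C i `|` S) by exact: measurableU.
have le1 : m B <= rk M ((S `|` D) `|` (C i `|` S)).
  rewrite -CD; apply: le_rmeas_rk.
  - exact: measurableU.
  - exact: indep_subset iB.
  - by move=> x [Cx|Dx]; [right; left|left; right].
have le2 : rk M (S `|` (C i `&` D)) <= rk M ((S `|` D) `&` (C i `|` S)).
  apply: le_rk; [|exact: measurableI|].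
    by apply: measurableU => //; exact: measurableI.
  by move=> x [Sx|[Cx Dx]]; split; [left|right|right|left].
have := rk_submod M mSD mCS; have := IH us.
rewrite -natr1 mulrDl mul1r; lra.
Qed.

(** Each [C i `|` H i] is independent, so it measures at most [m B1], while
    the deficits add up to at most [eps]: the [H i] nearly fill [B2], and the
    [C i] together measure at least [(q - 1) * m B1] by [rk_sum_ge] with [S]
    empty.  This bounds each of them and yields the last conclusion. *)
Lemma multiple_exchange (q : nat) (B1 B2 : set J) (X : 'I_q -> set J) (eps : R) :
  is_basis M B1 -> is_basis M B2 ->
  measurable_partition (mmeasure M) B1 X -> 0 < eps ->
  exists H : 'I_q -> set J, [/\ forall i, measurable (H i) /\ H i `<=` B2,
    forall i j x, H i x -> H j x -> i = j,
    m (B2 `\` \bigcup_i H i) <= eps,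
    forall i, indep M ((B1 `\` X i) `|` H i) &
    forall i, m B1 <= m ((B1 `\` X i) `|` H i) + eps].
Proof.
move=> b1 b2 [mX XX BX] e0.
have iB1 : indep M B1 by case: b1. have iB2 : indep M B2 by case: b2.
have mB1 := indep_measurable iB1; have mB2 := indep_measurable iB2.
have B21 : m B2 = m B1 by rewrite !basis_rk.
pose C i := B1 `\` X i.
have mC i : measurable (C i) by exact: measurableD.
have CB i : measurable (C i) /\ C i `<=` B1 by split=> // x [].
have iC i : indep M (C i) by apply: indep_subset iB1 => //; case: (CB i).
have CC i j : i != j -> m (B1 `\` (C i `|` C j)) = 0.
  move=> /XX; have mXX : measurable (X i `&` X j) by exact: measurableI.
  rewrite (rmeasE _ mXX) => -[XX0]; apply/eqP; rewrite eq_le rmeas_ge0 andbT -XX0.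
  apply: le_rmeas => //; first by apply: measurableD => //; exact: measurableU.
  move=> x [Bx nC]; split; apply: contrapT => nX; apply: nC; [left|right]; by split.
have mbigX : measurable (\bigcup_i X i).
  by apply: fin_bigcup_measurable => //; exact: finite_finset.
have leX : m B1 <= \sum_i m (B1 `&` X i).
  have BX0 : m (B1 `\` \bigcup_i X i) <= 0.
    have mBX : measurable ((B1 `\` \bigcup_i X i) `|` (\bigcup_i X i `\` B1)).
      by apply: measurableU; exact: measurableD.
    move: BX; rewrite /eq_mod (rmeasE _ mBX) => -[<-].
    by apply: le_rmeas => //; exact: measurableD.
  rewrite (rmeas_split _ mB1 mbigX) -[leRHS]add0r lerD//.
  apply: rmeas_le_sum => //; [by move=> i; exact: measurableI|exact: measurableI|].
  by move=> x [Bx [i _ Xx]]; exists i => //; rewrite mem_index_enum.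
have sumC : \sum_i m (B1 `&` X i) + \sum_i m (C i) = q%:R * m B1.
  rewrite -big_split/= (eq_bigr (fun=> m B1)).
    by rewrite sumr_const card_ord mulr_natl.
  by move=> i _; rewrite [RHS](rmeas_split _ mB1 (mX i)) addrC.
have rksum S : measurable S -> S `<=` B2 ->
    q%:R * m B1 + m S <= m B1 + \sum_i rk M (C i `|` S).
  move=> mS SB; have iS : indep M S by exact: indep_subset iB2.
  have := rk_sum_ge b1 CB CC mS (index_enum_uniq 'I_q).
  have -> : size (index_enum 'I_q) = q by rewrite -sum1_size sum1_card card_ord.
  apply: le_trans; rewrite lerD2l -rk_indep//; apply: le_rk => //.
  apply: measurableU => //; elim/big_ind : _ => // *; exact: measurableI.
have [S mS SB|H [mH HH HC HE]] := almost_partition iC mB2 _ e0.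
  by have := rksum S mS SB; lra.
have mbigH : measurable (\bigcup_i H i).
  by apply: fin_bigcup_measurable => [|i _]; [exact: finite_finset|case: (mH i)].
exists H; split=> // i; first by case: (HC i).
have CHE j : m (C j `|` H j) = m (C j) + m (H j).
  by rewrite rmeasU//; [case: (mH j)|rewrite setIC; case: (HC j)].
have slack j : 0 <= m B1 - (m (C j) + m (H j)).
  by rewrite subr_ge0 -CHE (basis_rk b1); apply: le_rmeas_rk => //; case: (HC j).
have slack_sum : \sum_j (m B1 - (m (C j) + m (H j))) <= eps.
  rewrite sumrB sumr_const card_ord -mulr_natl big_split/=.
  have := rksum _ measurable0 (@sub0set _ _); rewrite rmeas0.
  have -> : \sum_j rk M (C j `|` set0) = \sum_j m (C j).
    by apply: eq_bigr => j _; rewrite setU0 rk_indep.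
  have : m B2 <= m (B2 `\` \bigcup_i H i) + \sum_i m (H i).
    rewrite [leLHS](rmeas_split _ mB2 mbigH) lerD2l.
    apply: rmeas_le_sum; [by move=> j; case: (mH j)|exact: measurableI|].
    by move=> x [_ [j _ Hx]]; exists j => //; rewrite mem_index_enum.
  lra.
move: slack_sum; rewrite (bigD1 i)//= => slack_sum.
have : 0 <= \sum_(j < q | j != i) (m B1 - (m (C j) + m (H j))) by exact: sumr_ge0.
by have := CHE i; rewrite /C; lra.
Qed.

End bases.

Local Open Scope ereal_scope.

Theorem theorem7p20 (R : realType) (d : measure_display)
    (J : measurableType d) (M : measurable_matroid R J) (B1 B2 : set J)
    (hB1 : is_basis M B1) (hB2 : is_basis M B2)
    (q : nat) (X : 'I_q -> set J)
    (hX : measurable_partition (mmeasure M) B1 X)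
    (eps : R) (heps : (0 < eps)%R) :
  exists Y : 'I_q.+1 -> set J,
    [/\ measurable_partition (mmeasure M) B2 Y,
        mmeasure M (Y ord0) <= eps%:E,
        forall i : 'I_q, indep M ((B1 `\` X i) `|` Y (lift ord0 i))
      & forall i : 'I_q, exists Z : set J,
          [/\ measurable Z, mmeasure M Z <= eps%:E
            & is_basis M (((B1 `\` X i) `|` Y (lift ord0 i)) `|` Z)]].
Proof.
have [H [mH HH H0 iH lH]] := multiple_exchange hB1 hB2 hX heps.
have mB2 : measurable B2 by case: hB2 => /indep_measurable.
have mrest : measurable (B2 `\` \bigcup_i H i).
  apply: measurableD => //; apply: fin_bigcup_measurable => [|i _].
    exact: finite_finset.
  by case: (mH i).
pose Y (j : 'I_q.+1) := if unlift ord0 j is Some i then H i else B2 `\` \bigcup_i H i.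
have Y0 : Y ord0 = B2 `\` \bigcup_i H i by rewrite /Y unlift_none.
have YS i : Y (lift ord0 i) = H i by rewrite /Y liftK.
exists Y; split.
- split.
  + by move=> j; case: (unliftP ord0 j) => [i|] ->; rewrite ?Y0// YS; case: (mH i).
  + move=> j k jk; rewrite (_ : _ `&` _ = set0) ?measure0// -subset0 => x [].
    case: (unliftP ord0 j) jk => [i|] ->; case: (unliftP ord0 k) => [l|] ->;
      rewrite ?Y0 ?YS ?eqxx//.
    * by move=> /negP il Hi Hl; apply: il; rewrite (HH _ _ _ Hi Hl).
    * by move=> _ Hi [_]; apply; exists i.
    * by move=> _ [_ nH] Hl; apply: nH; exists l.
  + rewrite /eq_mod (_ : _ `|` _ = set0) ?measure0// -subset0 => x [[Bx nY]|[[j _ Yx] nB]].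
      apply: nY; have [[i _ Hx]|nH] := pselect ((\bigcup_i H i) x).
        by exists (lift ord0 i) => //; rewrite YS.
      by exists ord0 => //; rewrite Y0.
    apply: nB; move: Yx; case: (unliftP ord0 j) => [i|] ->; rewrite ?Y0 ?YS; last by case.
    by case: (mH i) => _; apply.
- by rewrite Y0 rmeasE// lee_fin.
- by move=> i; rewrite YS.
move=> i; rewrite YS.
have [G [iG HG _ Gr]] := rk_extend measurableT (iH i) (@subsetT _ _).
have mG := indep_measurable iG; have mCH := indep_measurable (iH i).
exists (G `\` ((B1 `\` X i) `|` H i)); split.
- exact: measurableD.
- rewrite rmeasE; last exact: measurableD.
  rewrite lee_fin; have := lH i; rewrite (basis_rk hB1) -Gr.
  by rewrite (rmeas_split _ mG mCH) (setIidr HG) addrC lerD2l.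
- by rewrite setDUK//; exact: rk_basis.
Qed.
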